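(* Assume $h_A=1$. A finite extension $L/E$ is cyclotomic coradical (with respect to $\rho$) if and only if it is separable, radical and $[L:E]=p^{m}$ for some integer $m\ge 0$.
   Context: Let $q$ be a power of a prime $p$, let $K$ be a global function field with constant field $\mathbb{F}_q$, let $\mathfrak{p}_\infty$ be a fixed place of $K$ and $A=\{x\in K\mid v_{\mathfrak p}(x)\ge 0 \text{ for every place } \mathfrak p\ne \mathfrak p_\infty\}$. The class number of the Dedekind ring $A$ is denoted $h_A$ (so $h_A=1$ means that $A$ is a principal ideal domain). Let $E$ be a finite extension of $K$ and let $\rho\colon A\to E\langle\tau\rangle$, $a\mapsto\rho_a$, be an $A$-Drinfeld module of rank one over $E$, of generic characteristic (its structural map $\delta\colon A\to E$ is the natural embedding); here $\tau$ is the $q$-Frobenius, and $\rho_a$ is also regarded as an $\mathbb{F}_q$-linear polynomial $\rho_a(U)\in E[U]$. All algebraic extensions of $E$ are taken inside a fixed algebraic closure $\overline{K}$ of $K$; any extension $L$ of $E$ is an $A$-module via $a\cdot u=\rho_a(u)$. For an ideal $I$ of $A$, $\rho[I]=\{u\in\overline K\mid \rho_c(u)=0\text{ for all }c\in I\}$, and $\rho[a]=\rho[(a)]$. For $a\in A\setminus\{0\}$, $\lambda_a$ denotes a generator of the cyclic $A$-module $\rho[a]$ (whether $\lambda_a$ lies in an extension of $E$ does not depend on the choice of generator). For an extension $L/E$ put $\mathrm{DrinT}(L/E)=\{u\in L\mid \text{there is } m\in A\setminus\{0\}\text{ with }\rho_m(u)\in E\}$. The extension $L/E$ is called radical if $L=E(X)$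 for some subset $X\subseteq \mathrm{DrinT}(L/E)$; it is called pure if for every irreducible $m\in A$, $\lambda_m\in L$ implies $\lambda_m\in E$; it is called cyclotomic coradical if it is radical, separable and pure. *)

(* Defs.v *)
From HB Require Import structures.
From mathcomp Require Import all_boot all_order all_algebra all_field.

Set Implicit Arguments.
Unset Strict Implicit.
Unset Printing Implicit Defensive.

Import Order.TTheory GRing.Theory Num.Theory.
Local Open Scope ring_scope.

(* The quotient of D by the relation R has exactly n elements. *)
Definition has_num_classes (T : Type) (D : T -> Prop) (R : T -> T -> Prop)
    (n : nat) : Prop :=
  exists r : 'I_n -> T,
    [/\ forall i, D (r i),
        forall i j, R (r i) (r j) -> i = j &
        forall x, D x -> exists i, R x (r i)].

(* A global function field is a finite extension K of F(t), F a finite field;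
   the choice of t plays no role beyond exhibiting K as such an extension. *)
Definition const_elt (F : finFieldType) (K : fieldExtType {fraction {poly F}})
    (c : F) : K := (FracField.tofrac c%:P)%:A.

Definition full_constant_field (F : finFieldType)
    (K : fieldExtType {fraction {poly F}}) : Prop :=
  forall x : K, algebraicOver (@const_elt F K) x ->
    exists c : F, x = const_elt K c.

(* A place is represented by its normalized discrete valuation. The value at 0,
   which should be +oo, is the dummy 0: hence distinct places are distinct
   functions, and 0 <= v 0 holds as it should. Triviality on a finite constant
   field is automatic, its nonzero elements being roots of unity. *)
Record place (K : fieldType) := Place {
  place_val :> K -> int;
  place_val0 : place_val 0 = 0;
  place_valM : forall x y, x != 0 -> y != 0 ->
    place_val (x * y) = place_val x + place_val y;
  place_valD : forall x y, x != 0 -> y != 0 -> x + y != 0 ->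
    Num.min (place_val x) (place_val y) <= place_val (x + y);
  place_uniformizer : exists2 x, x != 0 & place_val x = 1
}.

Definition regular_away (K : fieldType) (Pinf : place K) (x : K) : Prop :=
  forall v : place K, ~ (v =1 Pinf) -> 0 <= v x.

Section Subring.

Variables (K : fieldType) (A : K -> Prop).

Definition nonzero_ideal (I : K -> Prop) : Prop :=
  [/\ forall x, I x -> A x,
      I 0,
      forall x y, I x -> I y -> I (x + y),
      forall a x, A a -> I x -> I (a * x) &
      exists2 x, I x & x != 0].

Definition principal (a x : K) : Prop := exists2 b, A b & x = a * b.

Definition ideal_equiv (I J : K -> Prop) : Prop :=
  exists a b, [/\ A a /\ a != 0, A b /\ b != 0 &
    forall x, (exists2 y, I y & x = a * y) <-> (exists2 y, J y & x = b * y)].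

Definition class_number_is (h : nat) : Prop :=
  has_num_classes nonzero_ideal ideal_equiv h.

Definition quotient_card_is (a : K) (n : nat) : Prop :=
  has_num_classes A (fun x y => principal a (x - y)) n.

Definition is_unit_in (u : K) : Prop := A u /\ exists2 w, A w & u * w = 1.

Definition irreducible_in (m : K) : Prop :=
  [/\ A m, m != 0, ~ is_unit_in m &
      forall b c, A b -> A c -> m = b * c -> is_unit_in b \/ is_unit_in c].

End Subring.

(* An element \sum_i f_i tau^i of E<tau> is represented by the polynomial with
   coefficients f_i. Addition is that of {poly E}; the product below comes from
   tau * c = c^q * tau. *)
Definition tau_mul (E : fieldType) (q : nat) (f g : {poly E}) : {poly E} :=
  \poly_(k < size f + size g)
    \sum_(i < k.+1) f`_i * g`_(k - i) ^+ (q ^ i)%N.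

Definition linearized (E : fieldType) (q : nat) (f : {poly E}) : {poly E} :=
  \sum_(i < size f) f`_i *: 'X^(q ^ i)%N.

(* Only the values of rho on A matter. The structural map is the natural
   embedding a |-> a%:A of A in E, so the characteristic is generic. *)
Record drinfeld_module (F : finFieldType) (K : fieldExtType {fraction {poly F}})
    (A : K -> Prop) (E : fieldExtType K) (rho : K -> {poly E}) : Prop :=
  DrinfeldModule {
    drinfeldD : forall a b, A a -> A b -> rho (a + b) = rho a + rho b;
    drinfeldM : forall a b, A a -> A b ->
      rho (a * b) = tau_mul #|F| (rho a) (rho b);
    drinfeld_const : forall c : F,
      rho (const_elt K c) = ((const_elt K c)%:A)%:P;
    drinfeld_structural : forall a, A a -> (rho a)`_0 = a%:A;
    drinfeld_nontrivial : exists2 a, A a & (1 < size (rho a))%N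
  }.

Section DrinfeldModule.

Variables (q : nat) (K : fieldType) (A : K -> Prop).
Variables (E : fieldExtType K) (rho : K -> {poly E}).

(* deg_tau rho_a = r * deg a, where q ^ deg a = #(A / aA). *)
Definition has_rank (r : nat) : Prop :=
  forall a, A a -> a != 0 ->
    exists2 d, quotient_card_is A a (q ^ d)%N & size (rho a) = (r * d)%N.+1.

Definition drinfeld_act (M : fieldType) (f : E -> M) (a : K) (u : M) : M :=
  (map_poly f (linearized q (rho a))).[u].

Section Extension.

Variables (Kbar : fieldType) (iE : E -> Kbar).

Definition torsion (I : K -> Prop) (u : Kbar) : Prop :=
  forall c, I c -> drinfeld_act iE c u = 0.

Definition torsion_generator (a : K) (l : Kbar) : Prop :=
  torsion (principal A a) l /\
  forall u, torsion (principal A a) u ->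
    exists2 b, A b & u = drinfeld_act iE b l.

Variables (L : fieldExtType E) (iL : L -> Kbar).

Definition DrinT (u : L) : Prop :=
  exists m, [/\ A m, m != 0 &
    exists e : E, drinfeld_act (in_alg L) m u = e%:A].

Definition adjoin_full (X : L -> Prop) : Prop :=
  forall M : {subfield L}, (forall x, X x -> x \in M) -> forall y, y \in M.

Definition radical_ext : Prop :=
  exists X : L -> Prop, (forall x, X x -> DrinT x) /\ adjoin_full X.

Definition separable_ext : Prop := separable 1%VS (fullv : {vspace L}).

Definition pure_ext : Prop :=
  forall m, irreducible_in A m -> forall l, torsion_generator m l ->
    (exists x : L, l = iL x) -> exists e : E, l = iE e.

Definition cyclotomic_coradical : Prop :=
  [/\ radical_ext, separable_ext & pure_ext].

End Extension.

End DrinfeldModule.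

(* Main.v *)
Require Import Defs.
From HB Require Import structures.
From mathcomp Require Import all_boot all_order all_algebra.
From mathcomp Require Import all_fingroup all_solvable all_field.
From Stdlib Require Import Classical.

Set Implicit Arguments.
Unset Strict Implicit.
Unset Printing Implicit Defensive.

Import Order.TTheory GRing.Theory Num.Theory.
Local Open Scope ring_scope.

(** Since [h_A = 1], an irreducible [m] of [A] generates a maximal ideal, and
    since [rho] has rank one, [rho[m]] has exactly [#(A/m) = q^d] elements.
    Hence each nonzero point of [rho[m]] generates it as an [A]-module
    ([torsion_cyclic]), and all nonzero points of [rho[m]] generate the same
    field over any field that contains [E].  So all irreducible factors of
    [rho_m(U)/U], a polynomial of degree [q^d - 1], have the same degree, which
    is therefore prime to [p] ([p'_degree_of_root]).

    If [[L : E]] is a power of [p] and [lambda_m] lies in [L], then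
    [[E(lambda_m) : E]] is both prime to [p] and a power of [p], hence is 1: the
    extension is pure.

    Conversely, let [L/E] be radical and pure.  It is enough to show that
    [[E'(u) : E']] is a power of [p] whenever [E <= E' <= L] and
    [e = rho_m(u)] lies in [E'], for then a largest subfield of [L] of [p]-power
    degree over [E] contains every generator.  Factoring [m] one may suppose
    that it is irreducible.  The roots of [f = rho_m - e] form the coset
    [u + rho[m]].
    - If [rho[m]] lies in [E'], these roots all generate the same field over
      [E'], so [[E'(u) : E']] divides [deg f = q^d].
    - Otherwise pick [lambda <> 0] in [rho[m]].  Purity says that no nonzero
      point of [rho[m]] lies in [E'(u)].  Let [G] be the Galois group of the
      splitting field of [f], [N] the subgroup that fixes [lambda] and [G_u] the
      one that fixes [u].  By the above [N] is a normal [p]-subgroup of index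
      prime to [p], and [G_u] has order prime to [p].  The Schur-Zassenhaus
      theorem puts [G_u] inside a complement [H] of [N]; averaging [u] over [H]
      gives a root [w] of [f] fixed by [H].  Now [u - w] is a point of [rho[m]]
      fixed by [G_u], that is, in [E'(u)], so [u = w], [G_u = H] and
      [[E'(u) : E'] = #N].  This is [pnat_dim_of_torsor]. *)

(** * Splitting fields *)

Lemma irreducible_divisor_exists (F : fieldType) (p : {poly F}) :
  (1 < size p)%N -> exists2 r, irreducible_poly r & r %| p.
Proof.
have [n] := ubnP (size p); elim: n p => // n IHn p /ltnSE-le_p_n p_gt1.
have [irr_p | not_irr] := classic (irreducible_poly p); first by exists p.
have [r r_dv_p /andP[r_gt1 lt_r_p]] :
    exists2 r, r %| p & (1 < size r)%N && (size r < size p)%N.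
  apply: NNPP => no_r; apply: not_irr; split=> // r r_neq1 r_dv_p.
  have p_neq0 : p != 0 by rewrite -size_poly_gt0 ltnW.
  rewrite -dvdp_size_eqp // eqn_leq dvdp_leq //= leqNgt; apply/negP=> lt_r_p.
  case: no_r; exists r => //; rewrite lt_r_p andbT ltn_neqAle eq_sym r_neq1.
  by rewrite size_poly_gt0 (dvdpN0 r_dv_p).
have [s irr_s s_dv_r] := IHn r (leq_trans lt_r_p le_p_n) r_gt1.
by exists s => //; apply: dvdp_trans r_dv_p.
Qed.

(** The second clause says that the roots generate [L]; quantifying over
    subfields makes it pass easily through a tower of extensions. *)
Definition splits_with_roots (F : fieldType) (p : {poly F}) (L : fieldExtType F)
    (zs : seq L) :=
  map_poly (in_alg L) p %= \prod_(z <- zs) ('X - z%:P)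
  /\ forall U : {subfield L}, {subset zs <= U} -> forall x, x \in U.

(** Adjoin one root of an irreducible factor, then split the quotient over the
    larger field and view the result as an extension of the original one. *)
Lemma splitting_ext_exists (F : fieldType) (p : {poly F}) :
  p != 0 -> exists (L : fieldExtType F) (zs : seq L), splits_with_roots p zs.
Proof.
have [n] := ubnP (size p); elim: n F p => // n IHn F p /ltnSE-le_p_n p_neq0.
have [p_le1 | p_gt1] := leqP (size p) 1.
  exists F^o, [::]; split=> [|U _ x].
    by rewrite big_nil -size_poly_eq1 size_map_poly eqn_leq p_le1 size_poly_gt0.
  have -> : x = x *: (1 : F^o) by rewrite /GRing.scale /= mulr1.
  by rewrite memvZ ?mem1v.
have [r irr_r r_dv_p] := irreducible_divisor_exists p_gt1.
have [K _ [x rx0 defK]] := irredp_FAdjoin irr_r.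
have /factor_theorem[s Dp] : root (map_poly (in_alg K) p) x.
  by apply: root_dvdp rx0; rewrite dvdp_map.
have s_neq0 : s != 0.
  apply: contra_neq p_neq0 => s0; apply/eqP.
  by rewrite -(map_poly_eq0 (in_alg K)) Dp s0 mul0r.
have [|L [zs [Ds genL]]] := IHn K s _ s_neq0.
  move: le_p_n; rewrite -(size_map_poly (in_alg K)) Dp.
  by rewrite size_mul ?polyXsubC_eq0 // size_XsubC addn2.
exists (baseFieldType L), (x%:A :: zs); split.
  rewrite (eq_map_poly (fun a : F => baseField_scaleE a 1)).
  rewrite (map_poly_comp (in_alg L) (in_alg K)) Dp rmorphM /=.
  rewrite rmorphB /= map_polyX map_polyC /= big_cons mulrC.
  exact: eqp_mull Ds.
move=> U0 sub_zs_U0.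
(* [U0] contains [K], which is generated by [x] over [F], so it comes from a
   subfield of [L] over [K]. *)
have K_U0 (y : K) : (y%:A : L) \in U0.
  have: y \in <<1; x>>%VS by rewrite defK memvf.
  case/Fadjoin1_polyP=> f ->; rewrite -[_%:A]/(in_alg L _) -horner_map /=.
  rewrite -map_poly_comp -(eq_map_poly (fun a : F => baseField_scaleE a 1)).
  have U0x : (x%:A : L) \in U0 by rewrite sub_zs_U0 ?mem_head.
  apply: rpred_horner U0x; exact: alg_polyOver.
have F1_U0 : (refBaseField L <= U0)%VS.
  apply/subvP=> y; rewrite refBaseField.unlock mem_baseVspace.
  by case/vlineP=> a ->.
have [U _ memU] := module_baseAspace F1_U0.
move=> y; rewrite memU; apply: genL => z zs_z.
by rewrite -memU sub_zs_U0 // inE zs_z orbT.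
Qed.

Lemma splitting_field_exists (F : fieldType) (p : {poly F}) :
  p != 0 -> exists L : splittingFieldType F,
              splittingFieldFor 1 (map_poly (in_alg L) p) {:L}.
Proof.
move=> /splitting_ext_exists[L [zs [Dp genL]]].
have splitL : splittingFieldFor 1 (map_poly (in_alg L) p) {:L}.
  exists zs => //; apply/eqP; rewrite eqEsubv subvf /=; apply/subvP=> x _.
  by apply: genL => z; apply: seqv_sub_adjoin.
have axL : splitting_field_axiom L.
  by exists (map_poly (in_alg L) p) => //; apply: alg_polyOver.
pose splitM := FieldExt_isSplittingField.Build F L axL.
pose Ls : splittingFieldType F := HB.pack L splitM.
by exists Ls.
Qed.

(** * Degrees of roots *)

Lemma split_root_exists (F : fieldType) (h : {poly F}) (rs : seq F) :
  h %| \prod_(z <- rs) ('X - z%:P) -> (1 < size h)%N -> exists z, root h z.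
Proof.
move=> /dvdp_prod_XsubC[msk h_eq]; rewrite (eqp_size h_eq) size_prod_XsubC.
case: mask h_eq => // z zs h_eq _; exists z.
by rewrite (eqp_root h_eq) root_prod_XsubC mem_head.
Qed.

(** Over [K] the polynomial [h] is a product of minimal polynomials of its
    roots, all of degree [n]. *)
Lemma dvdn_size_equal_degree (F : fieldType) (L : fieldExtType F)
    (K : {subfield L}) (h : {poly L}) (rs : seq L) (n : nat) :
    h \is a polyOver K -> h %| \prod_(z <- rs) ('X - z%:P) ->
    (forall z, root h z -> adjoin_degree K z = n) ->
  (n %| (size h).-1)%N.
Proof.
have [m] := ubnP (size h); elim: m h => // m IHm h /ltnSE-le_h_m Kh h_split deg_h.
have [h_le1 | h_gt1] := leqP (size h) 1; first by case: (size h) h_le1 => [|[]].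
have h_neq0 : h != 0 by rewrite -size_poly_gt0 ltnW.
have [z hz0] := split_root_exists h_split h_gt1.
have Pz_dv_h := minPoly_dvdp Kh hz0.
set P := minPoly K z in Pz_dv_h.
have size_P : size P = n.+1 by rewrite size_minPoly deg_h.
have P_neq0 : P != 0 by rewrite -size_poly_gt0 size_P.
pose s := h %/ P; have Dh : s * P = h by apply: divpK.
have s_neq0 : s != 0 by apply: contra_neq h_neq0 => s0; rewrite -Dh s0 mul0r.
have n_gt0 : (0 < n)%N by rewrite -(deg_h z hz0).
have size_h : size h = ((size s).-1 + n).+1.
  by rewrite -Dh size_mul // size_P (polySpred s_neq0) addnS.
rewrite size_h /= dvdn_addl //; apply: IHm.
- apply: leq_trans le_h_m; rewrite size_h ltnS {1}(polySpred s_neq0).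
  by rewrite -[X in (X < _)%N]addn0 ltn_add2l.
- by rewrite divp_polyOver // minPolyOver.
- by apply: dvdp_trans h_split; rewrite -Dh dvdp_mulr.
- by move=> y sy0; apply: deg_h; rewrite -Dh rootM sy0.
Qed.

Lemma eq_adjoin_degree (F : fieldType) (L : fieldExtType F) (K : {subfield L})
    (s t : L) :
    s \in <<K; t>>%VS -> t \in <<K; s>>%VS ->
  adjoin_degree K s = adjoin_degree K t.
Proof.
move=> Ks Kt; rewrite !adjoin_degreeE; congr (\dim _ %/ _)%N.
apply/eqP; rewrite eqEsubv.
by apply/andP; split; apply/FadjoinP; split; rewrite ?subv_adjoin.
Qed.

(** The nonzero roots of [g] all generate the same field over [K], so
    their common degree divides the degree [p ^ n - 1] of [g / 'X]. *)
Lemma p'_degree_of_root (F : fieldType) (L : fieldExtType F) (K : {subfield L})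
    (p n : nat) (g : {poly L}) (rs : seq L) (l : L) :
    prime p -> g \is a polyOver K -> size g = (p ^ n).+1 ->
    root g 0 -> g^`().[0] != 0 -> g %| \prod_(z <- rs) ('X - z%:P) ->
    (forall s t, root g s -> root g t -> s != 0 -> t \in <<K; s>>%VS) ->
    root g l -> l != 0 ->
  ~~ (p %| adjoin_degree K l)%N.
Proof.
move=> pr_p Kg size_g g0 g'0 g_split gen gl l_neq0.
pose h := g %/ ('X - 0%:P).
have Dg : g = h * ('X - 0%:P) by rewrite divpK // dvdp_XsubCl.
have size_h : size h = (p ^ n)%N.
  by rewrite size_divp ?polyXsubC_eq0 // size_XsubC size_g subn1.
have h0 : ~~ root h 0.
  rewrite rootE; apply: contra_neq g'0 => h00.
  rewrite Dg derivM derivXsubC mulr1 hornerD hornerM hornerXsubC subrr.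
  by rewrite mulr0 add0r.
have hl : root h l by move: gl; rewrite Dg rootM root_XsubC (negPf l_neq0) orbF.
have h_gt1 : (1 < size h)%N.
  by apply: root_size_gt1 hl; rewrite -size_poly_gt0 size_h expn_gt0 prime_gt0.
have dvd_l : (adjoin_degree K l %| (size h).-1)%N.
  apply: (@dvdn_size_equal_degree _ _ K h rs).
  - by rewrite divp_polyOver // polyOverXsubC mem0v.
  - by apply: dvdp_trans g_split; rewrite Dg dvdp_mulr.
  move=> z hz; have z_neq0 : z != 0 by apply: contraNneq h0 => <-.
  have gz : root g z by rewrite Dg rootM hz.
  by apply: eq_adjoin_degree; apply: gen.
have p_h : (p %| size h)%N.
  rewrite size_h; case: n {size_g} size_h => [|n] size_h.
    by rewrite size_h in h_gt1.
  by rewrite expnS dvdn_mulr.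
apply/negP=> /dvdn_trans/(_ dvd_l) p_h1.
have : (p %| 1)%N by rewrite -(dvdn_addr 1 p_h1) addn1 prednK // ltnW.
by rewrite dvdn1 => /eqP p1; rewrite p1 in pr_p.
Qed.

(** * Galois extensions with a normal Sylow subgroup *)

(** The conjugates of [u] lie in [u + V].  The subgroup that fixes [l] is a
    normal Sylow [p]-subgroup, so it has complements, one of which contains the
    stabiliser of [u].  Averaging [u] over that complement gives a point [w] of
    [u + V] that it fixes; as [V] meets [F(u)] trivially, [w = u] and the
    complement is the whole stabiliser. *)
Lemma pnat_dim_of_torsor (p : nat) (F : fieldType) (L : splittingFieldType F)
    (u l : L) (V : L -> Prop) :
    p \in [pchar F] -> galois 1 {:L} ->
    (forall s, s \in 'Gal({:L} / 1)%g -> s l \in <<1; l>>%VS) ->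
    ~~ (p %| \dim <<1; l>>)%N -> p.-nat (\dim_<<1; l>> {:L}) ->
    ~~ (p %| \dim_<<1; u>> {:L})%N ->
    V 0 -> (forall x y, V x -> V y -> V (x + y)) ->
    (forall s, s \in 'Gal({:L} / 1)%g -> V (s u - u)) ->
    (forall x, x \in <<1; u>>%VS -> V x -> x = 0) ->
  p.-nat (\dim <<1; u>>).
Proof.
move=> charF galL norm_l p'l p_Ll p'Lu V0 VD Vu Vu0.
have pr_p : prime p by case/andP: charF.
set G := ('Gal({:L} / 1))%G; set N := ('Gal({:L} / <<1; l>>))%G.
set U := ('Gal({:L} / <<1; u>>))%G.
have galoisE (E : {subfield L}) : galois E {:L}.
  by apply: galoisS galL; rewrite sub1v subvf.
have oG : #|G| = \dim {:L} by rewrite -galois_dim // dimv1 divn1.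
have oN : #|N| = \dim_<<1; l>> {:L} by rewrite -galois_dim.
have oU : #|U| = \dim_<<1; u>> {:L} by rewrite -galois_dim.
have sNG : N \subset G by apply: galS; rewrite sub1v.
have sUG : U \subset G by apply: galS; rewrite sub1v.
have nsNG : (N <| G)%g.
  rewrite /normal sNG; apply/subsetP=> s Gs.
  have s_l : (s @: <<1; l>>)%VS = <<1; l>>%VS.
    apply/eqP; rewrite eqEdim (kHom_dim (k1AHom _ _)) leqnn andbT.
    rewrite aimg_adjoin aimg1; apply/FadjoinP; split; first exact: sub1v.
    exact: norm_l.
  by rewrite inE gal_conjg s_l.
have iNG : #|G : N|%g = \dim <<1; l>>.
  apply/eqP; rewrite -(eqn_pmul2l (cardG_gt0 N)) Lagrange // oG oN.
  by rewrite -dim_sup_field ?subvf.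
have coNG : coprime #|N| #|G : N|%g.
  by rewrite iNG (@pnat_coprime p) ?oN // p'natE.
have coNU : coprime #|N| #|U|.
  by rewrite (@pnat_coprime p) ?oN // oU p'natE.
have solN : solvable N by apply: (@pgroup_sol _ p); rewrite /pgroup oN.
have [|C /complP[tiNC defG]] := splitsP (SchurZassenhaus_split _ nsNG).
  by rewrite /Hall sNG coNG.
have nNU : U \subset 'N(N)%g by apply: subset_trans (normal_norm nsNG).
(* Inside [N U] both [U] and [C :&: N U] are complements of [N], hence they
   are conjugate; so [U] lies in a conjugate [H] of [C]. *)
pose C1 := (C :&: (N <*> U))%G.
have defNU : (N * C1 = N <*> U)%g.
  rewrite group_modl ?joing_subl // defG; apply/setIidPr.
  by rewrite join_subG sNG.
have oC : #|C| = #|G : N|%g.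
  apply/eqP; rewrite -(eqn_pmul2l (cardG_gt0 N)) Lagrange // -TI_cardMg //.
  by rewrite defG.
have oC1 : #|U| = #|C1|.
  apply/eqP; rewrite -(eqn_pmul2l (cardG_gt0 N)) -!TI_cardMg.
  - by rewrite defNU norm_joinEr.
  - by apply/trivgP; rewrite -tiNC setIS ?subsetIl.
  - exact: coprime_TIg.
have sCG : C \subset G by rewrite -defG mulG_subr.
have [x Nx defU] : exists2 x, x \in N & U :=: (C1 :^ x)%g.
  apply: (SchurZassenhaus_trans_sol solN) => //; rewrite -?oC1 //.
  - by rewrite (subset_trans _ (normal_norm nsNG)) // subIset ?sCG.
  - by rewrite defNU joing_subr.
pose H := (C :^ x)%G.
have sUH : U \subset H by rewrite defU conjSg subsetIl.
have sHG : H \subset G by rewrite conj_subG ?(subsetP sNG).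
have oH : #|H| = #|G : N|%g by rewrite cardJg oC.
(* [j] is an inverse of [#|H|] modulo [p]: dividing by [#|H|] this way uses
   only that [V] is closed under addition. *)
have [j jH1] : exists j, (#|H| * j)%:R = 1 :> L.
  have /coprimeP : coprime #|H| p.
    by rewrite oH iNG coprime_sym prime_coprime.
  rewrite cardG_gt0 => /(_ isT)[[i j] /= ij]; exists i.
  rewrite mulnC; have -> : (i * #|H| = 1 + j * p)%N.
    by rewrite -ij subnK // ltnW // -subn_gt0 ij.
  have charL : p \in [pchar L] by rewrite pchar_lalg.
  by rewrite natrD natrM (pcharf0 charL) mulr0 addr0.
pose w := (\sum_(h in H) h u) *+ j.
have wE : w - u = (\sum_(h in H) (h u - u)) *+ j.
  rewrite sumrB mulrnBl sumr_const -mulrnA -[u *+ (_ * _)]mulr_natr jH1.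
  by rewrite mulr1.
have Vw : V (w - u).
  rewrite wE; elim: j {jH1 w wE} => [|j IHj]; first by rewrite mulr0n.
  rewrite mulrS; apply: (VD _ _ _ IHj); apply: (big_ind V V0 VD) => // h Hh.
  by apply: Vu; apply: (subsetP sHG).
have wH (h : gal_of {:L}) : h \in H -> h w = w.
  move=> Hh; rewrite rmorphMn rmorph_sum /=; congr (_ *+ _).
  rewrite [RHS](reindex_acts 'R _ Hh) ?astabsR //=.
  by apply: eq_bigr => h' Hh'; rewrite galM ?memvf.
have w_u : w = u.
  apply/eqP; rewrite -subr_eq0; apply/eqP; apply: Vu0 Vw.
  rewrite rpredB ?memv_adjoin // -(galois_fixedField (galoisE <<1; u>>%AS)).
  apply/fixedFieldP; first exact: memvf.
  by move=> h Uh; apply: wH; apply: (subsetP sUH).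
have sHU : H \subset U.
  rewrite galois_connection ?subvf //; apply/FadjoinP; split; first exact: sub1v.
  by apply/fixedFieldP=> [|h Hh]; rewrite ?memvf // -w_u wH.
have oUN : #|U| = #|G : N|%g.
  by rewrite -oH; apply/eqP; rewrite eqn_leq !subset_leq_card.
rewrite (_ : \dim <<1; u>> = #|N|) ?oN //.
apply/eqP; rewrite -(eqn_pmul2r (cardG_gt0 U)) {1}oU mulnC -dim_sup_field ?subvf //.
by rewrite -oN -oG oUN Lagrange.
Qed.

(** * Additive polynomials *)

Lemma horner_linearized (R : fieldType) (q n : nat) (c : {poly R}) (x : R) :
  (size c <= n)%N -> (linearized q c).[x] = \sum_(i < n) c`_i * x ^+ (q ^ i).
Proof.
move=> le_c_n; rewrite horner_sum.
under eq_bigr do rewrite hornerZ hornerXn.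
rewrite (big_ord_widen _ (fun i => c`_i * x ^+ (q ^ i)) le_c_n) big_mkcond /=.
apply: eq_bigr => i _; case: ltnP => // le_c_i.
by rewrite nth_default ?mul0r.
Qed.

Lemma map_linearized (R S : fieldType) (f : {rmorphism R -> S}) (q : nat)
    (c : {poly R}) :
  map_poly f (linearized q c) = linearized q (map_poly f c).
Proof.
rewrite /linearized rmorph_sum size_map_poly; apply: eq_bigr => i _.
by rewrite /= map_polyZ map_polyXn coef_map.
Qed.

Lemma size_linearized (R : fieldType) (q : nat) (c : {poly R}) :
  (1 < q)%N -> c != 0 -> size (linearized q c) = (q ^ (size c).-1).+1.
Proof.
move=> q_gt1 c_neq0; rewrite /linearized (polySpred c_neq0) big_ord_recr /=.
have lead_neq0 : c`_(size c).-1 != 0 by rewrite -lead_coefE lead_coef_eq0.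
rewrite addrC size_polyDl size_scale ?size_polyXn // ltnS.
apply: leq_trans (size_sum _ _ _) _; apply/bigmax_leqP=> i _.
apply: leq_trans (size_scale_leq _ _) _.
by rewrite size_polyXn ltn_exp2l.
Qed.

Lemma linearized0 (R : fieldType) (q : nat) (c : {poly R}) :
  (0 < q)%N -> (linearized q c).[0] = 0.
Proof.
move=> q_gt0; rewrite (horner_linearized _ _ (leqnn _)) big1 // => i _.
by rewrite expr0n expn_eq0 -leqn0 leqNgt q_gt0 mulr0.
Qed.

Section Frobenius.

Variables (R : fieldType) (p q : nat).
Hypotheses (charR : p \in [pchar R]) (p_q : p.-nat q).

Lemma pchar_nat_exp i : [pchar R].-nat (q ^ i)%N.
Proof.
by rewrite (eq_pnat _ (pcharf_eq charR)) pnatX p_q.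
Qed.

Lemma linearizedD (c : {poly R}) : {morph horner (linearized q c) : x y / x + y}.
Proof.
move=> x y; rewrite !(horner_linearized _ _ (leqnn _)) -big_split /=.
by apply: eq_bigr => i _; rewrite exprDn_pchar ?pchar_nat_exp ?mulrDr.
Qed.

Lemma linearizedB (c : {poly R}) : {morph horner (linearized q c) : x y / x - y}.
Proof.
by move=> x y; apply: (addIr (linearized q c).[y]); rewrite -linearizedD !subrK.
Qed.

(** In characteristic [p] only the term of exponent [q ^ 0 = 1] survives.  As
    the constant coefficient of [rho_m] is [m], this makes [rho_m] separable. *)
Lemma deriv_linearized (c : {poly R}) :
  (1 < q)%N -> (linearized q c)^`() = (c`_0)%:P.
Proof.
move=> q_gt1.
have p_dv_q : (p %| q)%N.
  have [[|e] Dq] := p_natP p_q; first by rewrite Dq in q_gt1.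
  by rewrite Dq expnS dvdn_mulr.
have q_0 : q%:R = 0 :> R by apply/eqP; rewrite -(dvdn_pcharf charR).
rewrite raddf_sum /=; case: (posnP (size c)) => [c0 | c_gt0].
  by rewrite c0 big_ord0 nth_default ?c0.
rewrite -(prednK c_gt0) big_ord_recl big1 /= => [|i _].
  by rewrite derivZ derivXn expr0 addr0 alg_polyC.
rewrite derivZ derivXn -mulr_natr /bump add1n expnS natrM.
by rewrite -[q%:R]polyC_natr q_0 mul0r mulr0 scaler0.
Qed.

End Frobenius.

Lemma triangular_sum (V : nmodType) (a : nat -> nat -> V) (n : nat) :
  \sum_(k < n) \sum_(i < k.+1) a i (k - i)%N
    = \sum_(i < n) \sum_(j < n - i) a i j.
Proof.
elim: n => [|n IHn]; first by rewrite !big_ord0.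
rewrite big_ord_recr IHn [RHS]big_ord_recr /= subSnn big_ord1.
rewrite big_ord_recr /= addrA subnn; congr (_ + _).
rewrite -big_split; apply: eq_bigr => i _ /=.
by rewrite subSn 1?ltnW // big_ord_recr.
Qed.

Section TauMul.

Variables (R : fieldType) (p q : nat).
Hypotheses (charR : p \in [pchar R]) (p_q : p.-nat q).

(** Multiplication in [E<tau>] is composition of the additive polynomials; both
    sides are sums of the same terms, over a triangle and over a rectangle
    outside of which the terms vanish. *)
Lemma linearized_tau_mul (f g : {poly R}) (x : R) :
  (linearized q (tau_mul q f g)).[x] = (linearized q f).[(linearized q g).[x]].
Proof.
have q_gt0 : (0 < q)%N by case/andP: p_q.
pose a i j := f`_i * (g`_j * x ^+ (q ^ j)) ^+ (q ^ i).
set n := (size f + size g)%N.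
rewrite (@horner_linearized _ _ n) ?size_poly //.
transitivity (\sum_(k < n) \sum_(i < k.+1) a i (k - i)%N).
  apply: eq_bigr => k _; rewrite coef_poly ltn_ord mulr_suml.
  apply: eq_bigr => i _; rewrite /a exprMn -mulrA -exprM -expnD.
  by rewrite subnK // -ltnS.
rewrite triangular_sum (@horner_linearized _ _ n) ?leq_addr //.
apply: eq_bigr => i _; have [le_f_i | lt_i_f] := leqP (size f) i.
  by rewrite nth_default // mul0r big1 // => j _; rewrite /a nth_default ?mul0r.
rewrite -mulr_sumr; congr (_ * _).
rewrite (@horner_linearized _ _ (n - i)%N); last first.
  by rewrite leq_subRL ?leq_add2r ltnW // (leq_trans lt_i_f) ?leq_addr.
rewrite (big_morph (fun y => y ^+ (q ^ i)) (id1 := 0) (op1 := +%R)) //.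
  by move=> y z; rewrite exprDn_pchar ?(pchar_nat_exp charR).
by rewrite expr0n expn_eq0 -leqn0 leqNgt q_gt0.
Qed.

End TauMul.

Lemma map_tau_mul (R S : fieldType) (j : {rmorphism R -> S}) (q : nat)
    (f g : {poly R}) :
  map_poly j (tau_mul q f g) = tau_mul q (map_poly j f) (map_poly j g).
Proof.
apply/polyP=> k; rewrite coef_map !coef_poly !size_map_poly.
case: ifP => _; last exact: rmorph0.
rewrite /= rmorph_sum; apply: eq_bigr => i _.
by rewrite /= rmorphM rmorphXn !coef_map.
Qed.

(** The leading coefficient of the product is [lead f * lead g ^ (q ^ deg f)]. *)
Lemma size_tau_mul (R : fieldType) (q : nat) (f g : {poly R}) :
  (0 < q)%N -> f != 0 -> g != 0 -> (size f + size g <= (size (tau_mul q f g)).+1)%N.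
Proof.
move=> q_gt0 f_neq0 g_neq0; rewrite (polySpred f_neq0) (polySpred g_neq0).
set m := (size f).-1; set n := (size g).-1.
rewrite addSn addnS !ltnS ltnNge; apply/negP=> size_fg.
have /eqP : (tau_mul q f g)`_(m + n) = 0 by rewrite nth_default.
rewrite coef_poly (polySpred f_neq0) (polySpred g_neq0) addSn addnS ltnW //.
have lt_m : (m < (m + n).+1)%N by rewrite ltnS leq_addr.
rewrite (bigD1 (Ordinal lt_m)) //= addKn big1 => [|i ne_i_m].
  rewrite addr0 mulf_eq0 expf_eq0 -!lead_coefE !lead_coef_eq0.
  by rewrite (negPf f_neq0) (negPf g_neq0) andbF.
have [lt_i_m | le_m_i] := ltnP i m; last first.
  rewrite nth_default ?mul0r // (polySpred f_neq0) ltn_neqAle le_m_i andbT.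
  by apply: contraNneq ne_i_m => m_i; apply/eqP/val_inj.
rewrite [g`_ _]nth_default ?expr0n.
  by rewrite expn_eq0 -leqn0 leqNgt q_gt0 mulr0.
by rewrite (polySpred g_neq0) ltn_subRL ltn_add2r.
Qed.

(** * Roots of a shifted additive polynomial *)

Lemma separable_linearized_sub (k : fieldType) (p q : nat) (c : {poly k}) (e : k) :
    p \in [pchar k] -> p.-nat q -> (1 < q)%N -> c`_0 != 0 ->
  separable_poly (linearized q c - e%:P).
Proof.
move=> chark p_q q_gt1 c0; rewrite separable_poly.unlock derivB derivC subr0.
rewrite (deriv_linearized chark) // coprimep_sym.
by rewrite (eqp_coprimepl _ (_ : _ %= 1)) ?coprime1p ?polyC_eqp1.
Qed.

Lemma dim_adjoin_root_irr (k : fieldType) (L : fieldExtType k) (P : {poly k})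
    (u : L) :
    irreducible_poly P -> root (map_poly (in_alg L) P) u ->
  map_poly (in_alg L) P %= minPoly 1 u /\ \dim <<1; u>> = (size P).-1.
Proof.
move=> [P_gt1 irrP] Pu0.
have /polyOver1P[m Dm] : minPoly 1 u \is a polyOver 1%VS by apply: minPolyOver.
have m_dv_P : m %| P.
  by rewrite -(dvdp_map (in_alg L)) -Dm minPoly_dvdp // alg_polyOver.
have m_eq_P : m %= P.
  apply: irrP => //; rewrite -(size_map_poly (in_alg L)) -Dm size_minPoly.
  by rewrite eqSS.
have eqP : map_poly (in_alg L) P %= minPoly 1 u.
  by rewrite Dm eqp_map eqp_sym.
split=> //; rewrite dim_Fadjoin dimv1 muln1.
by rewrite -(size_map_poly (in_alg L)) (eqp_size eqP) size_minPoly.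
Qed.

(** The field [k(u)] generated by a root [u] of the irreducible [P] is described
    through [P] alone, so that the statement can be transported to a subfield of
    a given extension: [P %| g \Po S] says that [S(u)] is a root of [g], and
    [P %| S - a%:P] that [S(u) = a].  The last hypothesis is thus purity of
    [k(u)/k], and the one before it says that the roots of [g] form a cyclic
    module under polynomials with coefficients in [k]. *)
Lemma pnat_degree_of_linearized_root (k : fieldType) (p q : nat) (c : {poly k})
    (e : k) (P : {poly k}) (g := linearized q c) :
    p \in [pchar k] -> p.-nat q -> (1 < q)%N -> c`_0 != 0 ->
    irreducible_poly P -> P %| g - e%:P ->
    (forall (L : fieldExtType k) (s t : L),
       root (map_poly (in_alg L) g) s -> root (map_poly (in_alg L) g) t ->
       s != 0 -> exists B : {poly k}, t = (map_poly (in_alg L) B).[s]) ->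
    (forall S : {poly k}, P %| g \Po S -> exists a : k, P %| S - a%:P) ->
  p.-nat (size P).-1.
Proof.
move=> chark p_q q_gt1 c0_neq0 irrP P_dv_f cyc pure.
have pr_p : prime p by case/andP: chark.
pose f := g - e%:P.
have sep_f : separable_poly f by apply: (separable_linearized_sub _ chark p_q).
have f_neq0 : f != 0 := separable_poly_neq0 sep_f.
have [L splitL] := splitting_field_exists f_neq0.
set gL := map_poly (in_alg L) g.
have fE : map_poly (in_alg L) f = gL - e%:A%:P by rewrite rmorphB /= map_polyC.
rewrite fE in splitL.
set fL := gL - _ in splitL fE.
have f1 : fL \is a polyOver 1%VS by rewrite -fE alg_polyOver.
have g1 : gL \is a polyOver 1%VS by apply: alg_polyOver.
have sep_fL : separable_poly fL by rewrite -fE separable_map.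
have galL : galois 1 {:L} by apply/splitting_galoisField; exists fL.
have [zs f_zs genL] := splitL.
have charL : p \in [pchar L] by rewrite pchar_lalg.
have gLE : gL = linearized q (map_poly (in_alg L) c) by apply: map_linearized.
have gD x y : gL.[x + y] = gL.[x] + gL.[y] by rewrite gLE (linearizedD charL).
have gB x y : gL.[x - y] = gL.[x] - gL.[y] by rewrite gLE (linearizedB charL).
have c_neq0 : c != 0 by apply: contra_neq c0_neq0 => ->; rewrite coef0.
have size_g : size gL = (q ^ (size c).-1).+1.
  by rewrite size_map_poly size_linearized.
have size_e : (size (- e%:A%:P : {poly L})%R <= 1)%N.
  by rewrite size_polyN size_polyC leq_b1.
have size_f : size fL = (q ^ (size c).-1).+1.
  by rewrite size_polyDl size_g // ltnS (leq_trans size_e) // expn_gt0 ltnW.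
have root_f x : root fL x = (gL.[x] == e%:A).
  by rewrite rootE !hornerE subr_eq0.
have [u Pu0] : exists u, root (map_poly (in_alg L) P) u.
  apply: (split_root_exists (rs := zs)); last by rewrite size_map_poly; case: irrP.
  by rewrite -(eqp_dvdr _ f_zs) -fE dvdp_map.
have [P_u dim_u] := dim_adjoin_root_irr irrP Pu0.
have fu : gL.[u] = e%:A.
  by apply/eqP; rewrite -root_f -fE; apply: root_dvdp Pu0; rewrite dvdp_map.
pose V := root gL.
have V_sub z : V (z - u) = root fL z.
  by rewrite /V rootE gB fu subr_eq0 -root_f.
have V0 : V 0 by rewrite /V rootE gLE linearized0 // ltnW.
have pureL x : x \in <<1; u>>%VS -> V x -> x \in 1%VS.
  case/Fadjoin1_polyP=> S -> VS.
  have [|a P_S] := pure S.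
    rewrite -(dvdp_map (in_alg L)) (eqp_dvdl _ P_u) minPoly_dvdp ?alg_polyOver //.
    by rewrite map_comp_poly rootE horner_comp.
  have /eqP : (map_poly (in_alg L) (S - a%:P)).[u] == 0.
    by apply: root_dvdp Pu0; rewrite dvdp_map.
  rewrite rmorphB /= map_polyC !hornerE => /eqP; rewrite subr_eq0 => /eqP ->.
  by rewrite memvZ ?mem1v.
have gen (K : {subfield L}) s t : V s -> V t -> s != 0 -> t \in <<K; s>>%VS.
  move=> Vs Vt s0; have [B ->] := cyc L s t Vs Vt s0.
  by apply: mempx_Fadjoin; apply: alg_polyOver.
have q_pnat : p.-nat (size fL).-1 by rewrite size_f pnatX p_q.
(* Once the roots of [g] lie in [K], the roots of [f], which differ from [u]
   by roots of [g], all generate [K(u)]. *)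
have deg_u (K : {subfield L}) : (forall x, V x -> x \in K) ->
    p.-nat (adjoin_degree K u).
  move=> VK; apply: pnat_dvd q_pnat.
  apply: (@dvdn_size_equal_degree _ _ K fL zs).
  - by apply: polyOverSv f1; apply: sub1v.
  - by rewrite -(eqp_dvdr _ f_zs).
  - move=> z; rewrite -V_sub => /VK Kzu.
    apply: eq_adjoin_degree.
      rewrite -[z](subrK u) rpredD ?memv_adjoin // (subvP (subv_adjoin _ _)) //.
    rewrite -[u](subKr z) rpredB ?memv_adjoin //.
    by rewrite (subvP (subv_adjoin _ _)).
(* If the roots of [g] all lie in [k] the previous remark applies with [K = k];
   otherwise some root [l] is outside [k], and purity forces [V] to meet [k(u)]
   in 0, since a common nonzero point would generate [l] over [k]. *)
have [V1 | V'1] := classic (forall x, V x -> x \in 1%VS).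
  by rewrite -dim_u dim_Fadjoin dimv1 muln1 deg_u.
have [l /(imply_to_and (V l))[Vl l'1]] := not_all_ex_not _ _ V'1.
have l_neq0 : l != 0 by apply/eqP=> l0; apply: l'1; rewrite l0 mem0v.
have Vu0 x : x \in <<1; u>>%VS -> V x -> x = 0.
  move=> Mx Vx; apply/eqP/negPn/negP=> x_neq0; apply: l'1.
  suffices /subvP/(_ l) : (<<1; x>> <= 1)%VS by apply; apply: gen.
  by apply/FadjoinP; split=> //; apply: pureL.
have g_split : gL %| \prod_(z <- [seq z - u | z <- zs]) ('X - z%:P).
  rewrite {1}(@all_roots_prod_XsubC _ gL [seq z - u | z <- zs]).
  - by rewrite dvdpZl // lead_coef_eq0 -size_poly_eq0 size_g.
  - by rewrite size_g -size_f (eqp_size f_zs) size_prod_XsubC size_map.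
  - apply/allP=> _ /mapP[z zs_z ->].
    by rewrite -/(V _) V_sub (eqp_root f_zs) root_prod_XsubC.
  - rewrite uniq_rootsE (map_inj_uniq (addIr _)) -separable_prod_XsubC.
    by rewrite -(eqp_separable f_zs).
have /p_natP[n Dqn] : p.-nat (q ^ (size c).-1)%N by rewrite pnatX p_q.
have deg_l (K : {subfield L}) : ~~ (p %| adjoin_degree K l)%N.
  apply: (p'_degree_of_root pr_p _ _ V0 _ g_split) Vl l_neq0 => //.
  - by apply: polyOverSv g1; apply: sub1v.
  - by rewrite size_g Dqn.
  - by rewrite gLE (deriv_linearized charL p_q) // hornerC coef_map fmorph_eq0.
  - exact: gen.
have full (K : {subfield L}) : u \in K -> l \in K -> K = {:L}%VS :> {vspace L}.
  move=> Ku Kl; apply/eqP; rewrite eqEsubv subvf -genL; apply/Fadjoin_seqP.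
  split=> [|z zs_z]; first exact: sub1v.
  rewrite -[z](subrK u) rpredD //.
  have /subvP lK : (<<1; l>> <= K)%VS by rewrite sub_adjoin1v.
  by apply: lK; apply: gen; rewrite ?V_sub ?(eqp_root f_zs) ?root_prod_XsubC.
have VL s x : s \in 'Gal({:L} / 1)%g -> root gL x -> V (s x).
  move=> Gs; apply: (@kHom_root_id _ _ 1%AS {:L}%AS s gL x) => //.
  - exact: sub1v.
  - exact: k1AHom.
  - exact: memvf.
rewrite -dim_u.
apply: (pnat_dim_of_torsor (l := l) (V := V)) => //.
- by move=> s Gs; apply: gen; rewrite // VL.
- by rewrite dim_Fadjoin dimv1 muln1.
- rewrite -(full <<<<1; l>>; u>>%AS) ?memv_adjoin //; last first.
    by rewrite (subvP (subv_adjoin _ _)) ?memv_adjoin.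
  rewrite -adjoin_degreeE; apply: deg_u => x Vx.
  exact: gen.
- rewrite -(full <<<<1; u>>; l>>%AS) ?memv_adjoin -?adjoin_degreeE //.
  by rewrite (subvP (subv_adjoin _ _)) ?memv_adjoin.
- by move=> x y; rewrite /V !rootE gD => /eqP-> /eqP->; rewrite addr0.
- move=> s Gs; rewrite V_sub; apply: (kHom_root_id (sub1v _) (k1AHom _ _)) => //.
    exact: memvf.
  by rewrite root_f fu.
Qed.

(** * The ring of elements regular away from one place *)

Definition is_subring (K : fieldType) (A : K -> Prop) : Prop :=
  [/\ A 1, forall x y, A x -> A y -> A (x - y) &
      forall x y, A x -> A y -> A (x * y)].

Lemma place_val1 (K : fieldType) (v : place K) : v 1 = 0.
Proof.
have := place_valM v (oner_neq0 K) (oner_neq0 K); rewrite mulr1.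
by rewrite -[X in X = _]addr0 => /addrI.
Qed.

Lemma place_valN (K : fieldType) (v : place K) (x : K) : v (- x) = v x.
Proof.
have vN1 : v (-1) = 0.
  have N1 : -1 != 0 :> K by rewrite oppr_eq0 oner_neq0.
  have := place_valM v N1 N1; rewrite mulrNN mulr1 place_val1.
  by move/esym/eqP; rewrite -mulr2n mulrn_eq0 => /eqP.
have [-> | x_neq0] := eqVneq x 0; first by rewrite oppr0.
by rewrite -mulN1r place_valM ?oppr_eq0 ?oner_neq0 // vN1 add0r.
Qed.

Lemma regular_away_subring (K : fieldType) (Pinf : place K) :
  is_subring (regular_away Pinf).
Proof.
split=> [v _ | x y Ax Ay v v_fin | x y Ax Ay v v_fin]; first by rewrite place_val1.
  have vx := Ax v v_fin; have vNy : 0 <= v (- y) by rewrite place_valN Ay.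
  have [x0 | x_neq0] := eqVneq x 0; first by rewrite x0 sub0r.
  have [y0 | y_neq0] := eqVneq (- y) 0; first by rewrite y0 addr0.
  have [xy0 | xy_neq0] := eqVneq (x - y) 0; first by rewrite xy0 place_val0.
  apply: le_trans (place_valD v x_neq0 y_neq0 xy_neq0).
  by rewrite le_min vx vNy.
have [->|x_neq0] := eqVneq x 0; first by rewrite mul0r place_val0.
have [->|y_neq0] := eqVneq y 0; first by rewrite mulr0 place_val0.
by rewrite place_valM // addr_ge0 ?Ax ?Ay.
Qed.

Section PrincipalDomain.

Variables (K : fieldType) (A : K -> Prop).
Hypotheses (ringA : is_subring A) (hA1 : class_number_is A 1).

Lemma subring1 : A 1.
Proof. by case: ringA. Qed.

Lemma subringB x y : A x -> A y -> A (x - y).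
Proof. by case: ringA => _ + _; apply. Qed.

Lemma subringM x y : A x -> A y -> A (x * y).
Proof. by case: ringA => _ _; apply. Qed.

Lemma subring0 : A 0.
Proof. by rewrite -(subrr 1); apply: subringB; apply: subring1. Qed.

Lemma subringD x y : A x -> A y -> A (x + y).
Proof.
move=> Ax Ay; rewrite -[y]opprK; apply: subringB => //.
by rewrite -sub0r; apply: subringB => //; apply: subring0.
Qed.

(** All nonzero ideals, the unit ideal included, are proportional to the one
    representative [r] of the only ideal class. *)
Lemma ideal_principal (I : K -> Prop) :
  nonzero_ideal A I -> exists2 i, I i & forall x, I x -> principal A i x.
Proof.
move=> idealI; have [r [_ _ rep]] := hA1.
have idealA : nonzero_ideal A A.
  split=> //; [exact: subring0 | exact: subringD | exact: subringM |].
  by exists 1; [exact: subring1 | exact: oner_neq0].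
have [i0 [a [b [[Aa a0] [Ab b0] aI]]]] := rep _ idealI.
have [i1 [a' [b' [[Aa' a'0] [Ab' b'0] a'A]]]] := rep _ idealA.
rewrite (ord1 i0) in aI; rewrite (ord1 i1) in a'A.
have [y0 r_y0 Dy0] : exists2 y, r ord0 y & a' * 1 = b' * y.
  by apply/a'A; exists 1 => //; apply: subring1.
have [i Ii Di] : exists2 i, I i & b * y0 = a * i by apply/aI; exists y0.
exists i => // x Ix.
have [y r_y Dy] : exists2 y, r ord0 y & a * x = b * y by apply/aI; exists x.
have [z Az Dz] : exists2 z, A z & b' * y = a' * z by apply/a'A; exists y.
exists z => //; apply: (mulfI a0); rewrite Dy mulrA -Di -mulrA; congr (_ * _).
by apply: (mulfI b'0); rewrite Dz mulrA -Dy0 mulr1.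
Qed.

(** The ideal generated by [m] and [b] is principal, and its generator divides
    [m] without being associate to it. *)
Lemma irreducible_bezout (m b : K) :
    irreducible_in A m -> A b -> ~ principal A m b ->
  exists2 c, A c & principal A m (b * c - 1).
Proof.
move=> [Am m_neq0 _ irr_m] Ab m'b.
pose I x := exists y z, [/\ A y, A z & x = m * y + b * z].
have idealI : nonzero_ideal A I.
  split.
  - move=> _ [y [z [Ay Az ->]]].
    by apply: subringD; apply: subringM.
  - by exists 0, 0; rewrite !mulr0 addr0; split=> //; apply: subring0.
  - move=> _ _ [y [z [Ay Az ->]]] [y' [z' [Ay' Az' ->]]].
    exists (y + y'), (z + z'); split; try exact: subringD.
    by rewrite !mulrDr addrACA.
  - move=> a _ Aa [y [z [Ay Az ->]]].
    exists (a * y), (a * z); split; try exact: subringM.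
    by rewrite mulrDr !(mulrCA a).
  exists m => //; exists 1, 0; rewrite mulr1 mulr0 addr0.
  by split=> //; [exact: subring1 | exact: subring0].
have [i Ii genI] := ideal_principal idealI.
have Ai : A i by case: idealI => + _ _ _ _; apply.
have [|c Ac Dm] := genI m.
  exists 1, 0; rewrite mulr1 mulr0 addr0.
  by split=> //; [exact: subring1 | exact: subring0].
have [|d Ad Db] := genI b.
  exists 0, 1; rewrite mulr1 mulr0 add0r.
  by split=> //; [exact: subring0 | exact: subring1].
case: (irr_m i c Ai Ac Dm) => [[_ [w Aw iw1]] | [_ [w Aw cw1]]].
  have [y [z [Ay Az Di]]] := Ii.
  exists (z * w); first exact: subringM.
  exists (- (y * w)).
    by rewrite -sub0r; apply: subringB; [exact: subring0 | exact: subringM].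
  by rewrite -iw1 Di mulrDl -!mulrA opprD addrCA subrr addr0 mulrN.
case: m'b; exists (w * d); first exact: subringM.
by rewrite Dm Db mulrA -(mulrA i) cw1 mulr1.
Qed.

End PrincipalDomain.

(** * Torsion of a rank one Drinfeld module *)

Section DrinfeldAction.

Variables (F : finFieldType) (p : nat) (charF : p \in [pchar F]).
Variables (K : fieldExtType {fraction {poly F}}) (A : K -> Prop).
Variables (E : fieldExtType K) (rho : K -> {poly E}).
Hypotheses (ringA : is_subring A) (hA1 : class_number_is A 1).
Hypotheses (rhoP : drinfeld_module A rho) (rank1 : has_rank #|F| A rho 1).

Local Notation act := (drinfeld_act #|F| rho).

Let pr_p : prime p. Proof. by case/andP: charF. Qed.

Let p_q : p.-nat #|F|.
Proof.
by rewrite -cardsT; apply: abelem_pgroup (fin_ring_pchar_abelem charF).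
Qed.

Let q_gt1 : (1 < #|F|)%N. Proof. exact: finNzRing_gt1. Qed.

Let charE : p \in [pchar E].
Proof.
rewrite pchar_lalg pchar_lalg.
apply: (rmorph_pchar (@FracField.tofrac {poly F})).
exact: (rmorph_pchar (@polyC F) charF).
Qed.

Let A1 := subring1 ringA.
Let AB := subringB ringA.
Let AM := subringM ringA.

Section Action.

Variables (R : fieldType) (j : {rmorphism E -> R}).

Let charR : p \in [pchar R]. Proof. exact: (rmorph_pchar j charE). Qed.

Lemma act_linearized a (x : R) :
  act j a x = (linearized #|F| (map_poly j (rho a))).[x].
Proof. by rewrite /drinfeld_act map_linearized. Qed.

Lemma actD a b (x : R) : A a -> A b -> act j (a + b) x = act j a x + act j b x.
Proof.
move=> Aa Ab; rewrite !act_linearized (drinfeldD rhoP) // rmorphD /=.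
set f := map_poly j _; set g := map_poly j _.
pose n := maxn (size f) (size g).
rewrite !(@horner_linearized _ _ n) ?leq_maxl ?leq_maxr ?size_polyD // -big_split /=.
by apply: eq_bigr => i _; rewrite coefD mulrDl.
Qed.

Lemma actM a b (x : R) : A a -> A b -> act j (a * b) x = act j a (act j b x).
Proof.
move=> Aa Ab; rewrite !act_linearized (drinfeldM rhoP) // map_tau_mul.
exact: linearized_tau_mul charR p_q _ _ _.
Qed.

Lemma actC a b (x : R) : A a -> A b -> act j a (act j b x) = act j b (act j a x).
Proof. by move=> Aa Ab; rewrite -!actM // mulrC. Qed.

Lemma act1 (x : R) : act j 1 x = x.
Proof.
have c1 : const_elt K (1 : F) = 1 by rewrite /const_elt !rmorph1 scale1r.
rewrite act_linearized -{1}c1 (drinfeld_const rhoP) c1 scale1r map_polyC /= rmorph1.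
rewrite (@horner_linearized _ _ 1) ?size_polyC ?leq_b1 //.
by rewrite big_ord1 coefC expn0 expr1 mul1r.
Qed.

Lemma act0 a : act j a 0 = 0.
Proof. by rewrite act_linearized linearized0 // ltnW. Qed.

Lemma actB a b (x : R) : A a -> A b -> act j (a - b) x = act j a x - act j b x.
Proof.
move=> Aa Ab; apply: (addIr (act j b x)); rewrite -actD ?subrK //.
exact: AB.
Qed.

Lemma rho_neq0 a : A a -> a != 0 -> rho a != 0.
Proof.
move=> Aa; apply: contra_neq => rho0; apply/eqP.
rewrite -(fmorph_eq0 (in_alg E)) /=.
by rewrite -(drinfeld_structural rhoP Aa) rho0 coef0.
Qed.

Lemma root_act a (x : R) :
  root (map_poly j (linearized #|F| (rho a))) x = (act j a x == 0).
Proof. by []. Qed.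

(** Otherwise [b] would be invertible modulo [m], and [s] would be killed by
    [1]. *)
Lemma annihilator_principal m b (s : R) :
    irreducible_in A m -> s != 0 -> act j m s = 0 -> A b -> act j b s = 0 ->
  principal A m b.
Proof.
move=> irr_m s_neq0 ms0 Ab bs0; apply: NNPP => m'b.
have [Am _ _ _] := irr_m.
have [c Ac [d Ad bc1]] := irreducible_bezout ringA hA1 irr_m Ab m'b.
move/eqP: s_neq0; apply; rewrite -[s]act1.
have -> : 1 = b * c - m * d by rewrite -bc1 subKr.
rewrite actB; [|exact: AM..].
by rewrite !actM // (actC _ Ab) // (actC _ Am) // ms0 bs0 !act0 subrr.
Qed.

(** Representatives of [A/m] give distinct multiples of [s], and rank one says
    that there are as many of them as the degree of [g]. *)
Lemma torsion_roots m (s : R) (g := map_poly j (linearized #|F| (rho m))) :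
    irreducible_in A m -> s != 0 -> act j m s = 0 ->
  exists bs : seq K, [/\ forall b, b \in bs -> A b,
    uniq [seq act j b s | b <- bs], all (root g) [seq act j b s | b <- bs]
    & size g = (size bs).+1].
Proof.
move=> irr_m s_neq0 ms0; have [Am m_neq0 _ _] := irr_m.
have [d [r [Ar r_inj _]]] := rank1 Am m_neq0; rewrite mul1n => size_m.
exists [seq r i | i <- enum 'I_(#|F| ^ d)]; split.
- by move=> _ /mapP[i _ ->].
- rewrite -map_comp map_inj_uniq ?enum_uniq // => i1 i2 /= eq12.
  apply: r_inj; apply: annihilator_principal irr_m s_neq0 ms0 _ _; first exact: AB.
  by rewrite actB // eq12 subrr.
- apply/allP=> _ /mapP[_ /mapP[i _ ->] ->].
  by rewrite root_act (actC _ Am) // ms0 act0.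
- rewrite size_map_poly size_linearized ?rho_neq0 // size_m.
  by rewrite size_map size_enum_ord.
Qed.

Lemma torsion_cyclic m (s t : R) :
    irreducible_in A m -> s != 0 -> act j m s = 0 -> act j m t = 0 ->
  exists2 b, A b & t = act j b s.
Proof.
move=> irr_m s_neq0 ms0 mt0.
have [bs [Abs uniq_bs root_bs size_g]] := torsion_roots irr_m s_neq0 ms0.
suffices /mapP[b bs_b ->] : t \in [seq act j b s | b <- bs].
  by exists b => //; apply: Abs.
apply/negPn/negP=> bs't.
have := @max_poly_roots _ (map_poly j (linearized #|F| (rho m)))
  (t :: [seq act j b s | b <- bs]).
rewrite -size_poly_eq0 size_g /= root_bs uniq_bs bs't root_act mt0 eqxx size_map.
by rewrite ltnn => /(_ isT isT isT).
Qed.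

End Action.

Lemma act_map (R S : fieldType) (j : {rmorphism E -> R}) (f : {rmorphism R -> S})
    (i : {rmorphism E -> S}) (a : K) (x : R) :
  (forall e, f (j e) = i e) -> f (act j a x) = act i a (f x).
Proof.
move=> fj; rewrite /drinfeld_act -horner_map -map_poly_comp /=.
by congr _.[_]; apply: eq_map_poly.
Qed.

(** [deg_tau (rho a) = 0] would mean that [A/a] has a single element. *)
Lemma nonunit_size a :
  A a -> a != 0 -> ~ is_unit_in A a -> (1 < size (rho a))%N.
Proof.
move=> Aa a_neq0 nu; have [d [r [Ar r_inj rep]]] := rank1 Aa a_neq0.
rewrite mul1n => ->; rewrite ltnS lt0n; apply/eqP=> d0; case: nu; split=> //.
move: r Ar r_inj rep; rewrite d0 expn0 => r Ar _ rep.
have [i0 r0] := rep 0 (subring0 ringA); have [i1 r1] := rep 1 A1.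
move: r0 r1; rewrite (ord1 i0) (ord1 i1) => -[b Ab Db] [c Ac Dc].
exists (c - b); first exact: AB.
by rewrite mulrBr -Db -Dc sub0r opprK subrK.
Qed.

Lemma size_rho_factor b c :
    A b -> A c -> b != 0 -> c != 0 -> ~ is_unit_in A b -> ~ is_unit_in A c ->
  (size (rho b) < size (rho (b * c)))%N /\ (size (rho c) < size (rho (b * c)))%N.
Proof.
move=> Ab Ac b0 c0 nb nc; rewrite (drinfeldM rhoP) //.
have := size_tau_mul (ltnW q_gt1) (rho_neq0 Ab b0) (rho_neq0 Ac c0).
have := nonunit_size Ab b0 nb; have := nonunit_size Ac c0 nc.
move: (size _) (size _) (size _) => x y z x1 y1 le.
split; rewrite -ltnS; apply: leq_trans le.
  by rewrite -addn2 leq_add2l.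
by rewrite -add2n leq_add2r.
Qed.

Lemma size_act_poly (R : fieldType) (j : {rmorphism E -> R}) m :
    A m -> m != 0 -> exists n,
  size (map_poly j (linearized #|F| (rho m))) = (p ^ n).+1.
Proof.
move=> Am m0; rewrite size_map_poly size_linearized ?rho_neq0 //.
have /p_natP[n ->] : p.-nat (#|F| ^ (size (rho m)).-1)%N by rewrite pnatX p_q.
by exists n.
Qed.

Lemma rho_coef0_neq0 m : A m -> m != 0 -> (rho m)`_0 != 0.
Proof.
move=> Am m0.
by rewrite (drinfeld_structural rhoP) // -[_%:A]/(in_alg E m) fmorph_eq0.
Qed.

(** ** Radical extensions *)

Section Extension.

Variables (Kbar : fieldType) (iE : {rmorphism E -> Kbar}).
Variables (L : fieldExtType E) (iL : {rmorphism L -> Kbar}).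
Hypothesis iL_iE : forall x : E, iL x%:A = iE x.

Local Notation pure := (pure_ext #|F| A rho iE iL).
Local Notation actL := (act (in_alg L)).

Lemma nonzero_torsion_generator m l :
    irreducible_in A m -> l != 0 -> act iE m l = 0 ->
  torsion_generator #|F| A rho iE m l.
Proof.
move=> irr_m l0 ml0; have [Am _ _ _] := irr_m.
split=> [_ [b Ab ->] | t mt].
  by rewrite (actM _ _ Am Ab) (actC _ _ Am Ab) ml0 act0.
apply: torsion_cyclic irr_m l0 ml0 _; apply: mt.
by exists 1; rewrite ?mulr1.
Qed.

Lemma torsion_of_generator m l :
  irreducible_in A m -> torsion_generator #|F| A rho iE m l -> act iE m l = 0.
Proof. by case=> Am _ _ _ [ml _]; apply: ml; exists 1; rewrite ?mulr1. Qed.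

Lemma iL_act a x : iL (actL a x) = act iE a (iL x).
Proof. exact: act_map. Qed.

Lemma pure_torsion m x :
  pure -> irreducible_in A m -> actL m x = 0 -> x \in 1%VS.
Proof.
move=> pureL irr_m mx0; have [-> | x0] := eqVneq x 0; first exact: mem0v.
have [||e xe] := pureL m irr_m (iL x).
- apply: nonzero_torsion_generator irr_m _ _; first by rewrite fmorph_eq0.
  by rewrite -iL_act mx0 rmorph0.
- by exists x.
by apply/vlineP; exists e; apply: (fmorph_inj iL); rewrite iL_iE.
Qed.

Lemma mem_act (K' : {subfield L}) a x : x \in K' -> actL a x \in K'.
Proof. by move=> Kx; rewrite rpred_horner ?alg_polyOver. Qed.

Lemma torsion_gen (K' : {subfield L}) m s t :
    irreducible_in A m -> actL m s = 0 -> actL m t = 0 -> s != 0 ->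
  t \in <<K'; s>>%VS.
Proof.
move=> irr_m ms mt s0; have [b _ ->] := torsion_cyclic irr_m s0 ms mt.
by apply: mem_act; apply: memv_adjoin.
Qed.

(** The degree of a torsion point is prime to [p] and divides [[L : E]]. *)
Lemma pure_of_pnat_dim : p.-nat (\dim {:L}) -> pure.
Proof.
move=> p_L m irr_m l gen_x [x Dl]; rewrite {l}Dl in gen_x *.
have [Am m0 _ _] := irr_m.
have mx : actL m x = 0.
  by apply: (fmorph_inj iL); rewrite iL_act rmorph0; apply: torsion_of_generator.
suffices /vlineP[e ->] : x \in 1%VS by exists e; rewrite iL_iE.
have [-> | x0] := eqVneq x 0; first exact: mem0v.
rewrite -adjoin_deg_eq1.
have [bs [_ uniq_bs root_bs size_g]] := torsion_roots irr_m x0 mx.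
set g := map_poly _ _ in root_bs size_g.
have [n size_gp] := size_act_poly (in_alg L) Am m0.
have g_neq0 : g != 0 by rewrite -size_poly_eq0 size_g.
have charL : p \in [pchar L] by rewrite pchar_lalg.
have g_split : g %| \prod_(z <- [seq actL b x | b <- bs]) ('X - z%:P).
  rewrite {1}(@all_roots_prod_XsubC _ g _ _ root_bs) ?size_map ?uniq_rootsE //.
  by rewrite dvdpZl // lead_coef_eq0.
have p'x : ~~ (p %| adjoin_degree 1 x)%N.
  apply: (p'_degree_of_root pr_p _ size_gp _ _ g_split) x0 => //.
  - exact: alg_polyOver.
  - by rewrite /g root_act act0.
  - rewrite /g map_linearized (deriv_linearized charL p_q) // hornerC.
    rewrite coef_map fmorph_eq0; exact: rho_coef0_neq0.
  - by move=> s t /eqP ms /eqP mt; apply: (torsion_gen _ irr_m).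
  - by rewrite /g root_act mx.
have : p.-nat (adjoin_degree 1 x).
  have <- : \dim <<1; x>> = adjoin_degree 1 x by rewrite dim_Fadjoin dimv1 muln1.
  exact: pnat_dvd (field_dimS (subvf _)) p_L.
case/p_natP=> -[|i] Dp; first by rewrite Dp.
by rewrite Dp expnS dvdn_mulr in p'x.
Qed.

(** The subfield [K'] becomes the base field [k], and [P] is the minimal
    polynomial of [u] over it.  Purity of [L/E] passes to [k(u)/k] because
    torsion points of [L] already lie in [E]. *)
Lemma pnat_degree_irreducible (K' : {subfield L}) m u :
    pure -> irreducible_in A m -> actL m u \in K' ->
  p.-nat (adjoin_degree K' u).
Proof.
move=> pureL irr_m K'mu; have [Am m0 _ _] := irr_m.
pose k := subvs_of K'.
have /polyOver_subvs[P DP] : minPoly K' u \is a polyOver K' by apply: minPolyOver.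
have size_P : size P = (adjoin_degree K' u).+1.
  by rewrite -size_minPoly DP size_map_poly.
have rootP : root (map_poly vsval P) u by rewrite -DP root_minPoly.
have P_dvd (S : {poly k}) : (P %| S) = root (map_poly vsval S) u.
  apply/idP/idP=> [P_S | Su]; first by apply: root_dvdp rootP; rewrite dvdp_map.
  rewrite -(dvdp_map vsval) -DP minPoly_dvdp //.
  by apply/polyOver_subvs; exists S.
have irrP : irreducible_poly P.
  split=> [|r r_neq1 r_P]; first by rewrite size_P.
  have : map_poly vsval r %| minPoly K' u by rewrite DP dvdp_map.
  case/minPoly_irr/orP=> [|rP|].
  - by apply/polyOver_subvs; exists r.
  - by rewrite DP eqp_map in rP.
  - by rewrite -size_poly_eq1 size_map_poly (negPf r_neq1).
pose c := map_poly (in_alg k) (rho m).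
have val_in_alg (a : E) : vsval (in_alg k a) = a%:A by rewrite /= algid1.
have map_g : map_poly vsval (linearized #|F| c)
    = map_poly (in_alg L) (linearized #|F| (rho m)).
  rewrite !map_linearized -map_poly_comp; congr linearized.
  exact: eq_map_poly.
have chark : p \in [pchar k] by rewrite pchar_lalg.
rewrite -[adjoin_degree _ _]/(_.+1.-1) -size_P.
apply: (@pnat_degree_of_linearized_root k p #|F| c (Subvs K'mu) P) => //.
- by rewrite coef_map fmorph_eq0 rho_coef0_neq0.
- by rewrite P_dvd rmorphB /= map_polyC map_g rootE !hornerE subrr.
- move=> M s t; pose j : {rmorphism E -> M} := in_alg M \o in_alg k.
  rewrite !map_linearized -map_poly_comp -(map_linearized j) !root_act.
  move=> /eqP ms /eqP mt s0.
  have [b _ ->] := torsion_cyclic irr_m s0 ms mt.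
  exists (map_poly (in_alg k) (linearized #|F| (rho b))).
  by rewrite -map_poly_comp.
- move=> S; rewrite P_dvd map_comp_poly map_g root_comp root_act => /eqP mS.
  have /vlineP[e De] := pure_torsion pureL irr_m mS.
  exists (in_alg k e); have := val_in_alg e; move: (in_alg k e) => a Da.
  by rewrite P_dvd rmorphB /= map_polyC /= Da rootE !hornerE De subrr.
Qed.

(** Induction on [deg_tau (rho m)]: if [m = b c] with [b], [c] not units, then
    [K' <= K'(rho_c(u)) <= K'(rho_c(u), u)] has two steps of lower degree. *)
Lemma pnat_degree_torsion (K' : {subfield L}) m u :
    pure -> A m -> m != 0 -> actL m u \in K' -> p.-nat (adjoin_degree K' u).
Proof.
move=> pureL; have [n] := ubnP (size (rho m)).
elim: n m u K' => // n IHn m u K' /ltnSE-le_m_n Am m0 K'mu.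
have [[_ [w Aw mw1]] | nu_m] := classic (is_unit_in A m).
  rewrite (_ : adjoin_degree K' u = 1%N) //; apply/eqP; rewrite adjoin_deg_eq1.
  by rewrite -[u](act1 (in_alg L)) -mw1 mulrC actM // mem_act.
have [irr_m | red_m] := classic (irreducible_in A m).
  exact: pnat_degree_irreducible irr_m K'mu.
have [b [c [Ab Ac Dm nu_b nu_c]]] : exists b c,
    [/\ A b, A c, m = b * c, ~ is_unit_in A b & ~ is_unit_in A c].
  apply: NNPP => no_bc; apply: red_m; split=> // b c Ab Ac Dm.
  apply: NNPP => /not_or_and[nu_b nu_c]; apply: no_bc.
  by exists b, c.
have [b0 c0] : b != 0 /\ c != 0 by apply/andP; rewrite -negb_or -mulf_eq0 -Dm.
have [lt_b lt_c] := size_rho_factor Ab Ac b0 c0 nu_b nu_c.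
rewrite -Dm in lt_b lt_c.
pose y := actL c u.
have deg_y : p.-nat (adjoin_degree K' y).
  apply: (IHn b) => //; first exact: leq_trans lt_b le_m_n.
  by rewrite /y -actM // -Dm.
have deg_u : p.-nat (adjoin_degree <<K'; y>> u).
  apply: (IHn c _ <<K'; y>>%AS) => //; first exact: leq_trans lt_c le_m_n.
  exact: memv_adjoin.
have p_yu : p.-nat (adjoin_degree <<K'; y>> u * adjoin_degree K' y).
  by rewrite pnatM deg_u.
apply: pnat_dvd p_yu; rewrite -(dvdn_pmul2r (adim_gt0 K')) -mulnA -!dim_Fadjoin.
apply: field_dimS; apply/FadjoinP; split; last exact: memv_adjoin.
by apply: subv_trans (subv_adjoin _ _); apply: subv_adjoin.
Qed.

Lemma pnat_dim_of_pure : radical_ext #|F| A rho L -> pure -> p.-nat (\dim {:L}).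
Proof.
move=> [X [X_DrinT genX]] pureL.
(* Induction on the codimension of a subfield [K'] of [p]-power degree: a
   generator outside [K'] enlarges it. *)
suffices: forall n (K' : {subfield L}), (\dim {:L} < n + \dim K')%N ->
    p.-nat (\dim K') -> p.-nat (\dim {:L}).
  by move/(_ (\dim {:L}) 1%AS); apply; rewrite dimv1 ?addn1.
elim=> [K'|n IHn K' lt_n p_K']; first by rewrite ltnNge dimvS ?subvf.
have [X_K' | X'K'] := classic (forall x, X x -> x \in K').
  suffices <- : (K' : {vspace L}) = {:L}%VS by [].
  by apply/eqP; rewrite eqEsubv subvf; apply/subvP=> x _; apply: genX.
have [x /(imply_to_and (X x))[Xx K'x]] := not_all_ex_not _ _ X'K'.
have [m [Am m0 [e mx]]] := X_DrinT x Xx.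
have p_x : p.-nat (adjoin_degree K' x).
  by apply: pnat_degree_torsion pureL Am m0 _; rewrite mx memvZ ?mem1v.
apply: (IHn <<K'; x>>%AS); last by rewrite dim_Fadjoin pnatM p_x.
apply: leq_trans lt_n _; rewrite addSnnS leq_add2l dim_Fadjoin.
rewrite -[X in (X < _)%N]mul1n ltn_pmul2r ?adim_gt0 // ltn_neqAle eq_sym.
by rewrite adjoin_deg_eq1 andbT; apply/negP.
Qed.

End Extension.
End DrinfeldAction.

Theorem corollary5p13 (F : finFieldType) (p : nat) (charF : p \in [pchar F])
    (K : fieldExtType {fraction {poly F}}) (constK : full_constant_field K)
    (Pinf : place K)
    (hA1 : class_number_is (regular_away Pinf) 1)
    (E : fieldExtType K) (rho : K -> {poly E})
    (rho_drinfeld : drinfeld_module (regular_away Pinf) rho)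
    (rho_rank1 : has_rank #|F| (regular_away Pinf) rho 1)
    (Kbar : closedFieldType) (iE : {rmorphism E -> Kbar})
    (Kbar_alg : forall z : Kbar, algebraicOver (fun x : K => iE x%:A) z)
    (L : fieldExtType E) (iL : {rmorphism L -> Kbar})
    (iL_iE : forall x : E, iL x%:A = iE x) :
  cyclotomic_coradical #|F| (regular_away Pinf) rho iE iL <->
  [/\ separable_ext L,
      radical_ext #|F| (regular_away Pinf) rho L &
      exists m : nat, \dim (fullv : {vspace L}) = (p ^ m)%N].
Proof.
have ringA := regular_away_subring Pinf.
split=> [[radL sepL pureL] | [sepL radL [m dimL]]]; split=> //.
  have p_L : p.-nat (\dim {:L}).
    exact: (pnat_dim_of_pure charF ringA hA1 rho_drinfeld rho_rank1 iL_iE).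
  by have [m dimL] := p_natP p_L; exists m.
apply: (pure_of_pnat_dim charF ringA hA1 rho_drinfeld rho_rank1 iL_iE).
by rewrite dimL pnatX pnat_id //; case/andP: charF.
Qed.
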